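(* Let $\mathbb{F}_q$ be a finite field, let $n$ be a divisor of $q-1$, let $\gamma\in\mathbb{F}_q^*$ have order $n$, and let $G=\langle\gamma\rangle$. Let $U$ be any subset of $\{0,1,\ldots,n-1\}$, let $N$ be an integer, let $H\le n$ be a positive integer and let $V=\{N,N+1,\ldots,N+H-1\}$. Let $f:G\times G\to G$ be any mapping having $(\ell_1,\ell_2)$ as an index pair and satisfying $f(\gamma^x,\gamma^y)=\gamma^{xy}$ for all $(x,y)\in U\times V$. Then $$\max\{\ell_1,\ell_2\}\ge\min\{|U|,H\}.$$
   Context: For a positive divisor $\ell$ of $n$, let $C_{\ell,0}=\{\gamma^{j\ell}: j=0,1,\ldots,n/\ell-1\}$ and $C_{\ell,i}=\gamma^i C_{\ell,0}$ for $i=0,1,\ldots,\ell-1$. For positive divisors $\ell_1,\ell_2$ of $n$, a pair $(\ell_1,\ell_2)$ is called an index pair of a mapping $f:G\times G\to G$ if there exist positive integers $r_1,r_2$ and elements $a_{k_1,k_2}\in G$ ($0\le k_1\le \ell_1-1$, $0\le k_2\le \ell_2-1$) such that $f(x,y)=a_{k_1,k_2}x^{r_1}y^{r_2}$ whenever $(x,y)\in C_{\ell_1,k_1}\times C_{\ell_2,k_2}$. *)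

(* Defs.v *)
From mathcomp Require Import all_boot all_order all_algebra all_fingroup.

Set Implicit Arguments.
Unset Strict Implicit.
Unset Printing Implicit Defensive.

(* Integer powers in a finite group: the library has them only in unit rings. *)
Definition expgz (gT : finGroupType) (x : gT) (m : int) : gT :=
  match m with
  | Posz k => (x ^+ k)%g
  | Negz k => (x ^- k.+1)%g
  end.

Section IndexPair.
Local Open Scope group_scope.
Variables (gT : finGroupType) (g : gT).

Definition cyclo_class0 (l : nat) : {set gT} :=
  [set g ^+ (j * l) | j : 'I_(#[g] %/ l)].

Definition cyclo_class (l i : nat) : {set gT} := g ^+ i *: cyclo_class0 l.

(* A mapping G x G -> G, where G = <[g]>, is represented by a function on the
   ambient group that sends G x G into G; its values elsewhere are irrelevant. *)
Definition maps_into (f : gT * gT -> gT) : Prop :=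
  forall x y, x \in <[g]> -> y \in <[g]> -> f (x, y) \in <[g]>.

(* Positivity of l1 and l2 follows from divisibility, since 0 < #[g]. *)
Definition index_pair (f : gT * gT -> gT) (l1 l2 : nat) : Prop :=
  [/\ l1 %| #[g], l2 %| #[g] &
    exists r1 r2 : nat, exists a : 'I_l1 -> 'I_l2 -> gT,
      [/\ 0 < r1, 0 < r2,
          forall k1 k2, a k1 k2 \in <[g]> &
          forall (k1 : 'I_l1) (k2 : 'I_l2) (x y : gT),
            x \in cyclo_class l1 k1 -> y \in cyclo_class l2 k2 ->
            f (x, y) = a k1 k2 * x ^+ r1 * y ^+ r2]].

End IndexPair.

(* Main.v *)
(** There is an [r] such that [f(g^x, y) / f(g^x', y) = g^(r (x - x'))] for all [y] whenever [x]
    and [x'] are congruent modulo [l1]. By pigeonhole two distinct such [x] and [x'] lie in [U]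
    when [l1 < #|U|]. Comparing [y = g^N] with [y = g^(N+1)], where the ratio is
    [g^((x - x') N)] and [g^((x - x') (N+1))], forces [g^x = g^x'], a contradiction. *)
Require Import Defs.
From mathcomp Require Import all_boot all_order all_algebra all_fingroup.
From mathcomp Require Import cyclic.

Import Order.TTheory GRing.Theory Num.Theory.

Section IntegerPowers.
Local Open Scope group_scope.
Variables (gT : finGroupType) (g : gT).

Lemma mem_cycle_expgz (m : int) : expgz g m \in <[g]>.
Proof. by case: m => k; rewrite /= ?groupV mem_cycle. Qed.

Lemma expgzS (m : int) : expgz g (m + 1)%R = expgz g m * g.
Proof.
case: m => [k|[|k]]; first by rewrite -PoszD addn1 /= expgSr.
  (* [Negz 0] is -1, the one negative integer whose successor leaves the [Negz] constructor. *)
  by rewrite /= mulVg.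
have -> : (Negz k.+1 + 1 = Negz k)%R by rewrite !NegzE -addn1 PoszD opprD subrK.
by rewrite /= (expgS g k.+1) invMg mulgKV.
Qed.

Lemma expgzDn (m : int) (k : nat) : expgz g (m + k%:Z)%R = expgz g m * g ^+ k.
Proof.
elim: k => [|k IHk]; first by rewrite addr0 mulg1.
by rewrite -addn1 PoszD addrA expgzS IHk addn1 expgSr mulgA.
Qed.

End IntegerPowers.

Section CyclotomicClasses.
Local Open Scope group_scope.
Variables (gT : finGroupType) (g : gT).

Lemma mem_cyclo_class (l x : nat) :
  l %| #[g] -> x < #[g] -> g ^+ x \in cyclo_class g l (x %% l).
Proof.
move=> l_dvd x_lt; have l_gt0 := dvdn_gt0 (order_gt0 g) l_dvd.
have q_lt : x %/ l < #[g] %/ l by rewrite ltn_divLR // divnK.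
(* The quotient [x %/ l] is the index [j] inside [cyclo_class0]. *)
rewrite {1}(divn_eq x l) addnC expgD mem_lcoset mulKg.
by apply/imsetP; exists (Ordinal q_lt).
Qed.

(** The two values share the coefficient [a k1 k2] and the factor coming from [y], so only the
    powers with exponent [r1] differ. Cross-multiplying avoids the possibly negative exponent
    [x - x']. *)
Lemma index_pair_ratio (f : gT * gT -> gT) (l1 l2 : nat) :
  index_pair g f l1 l2 ->
  exists r : nat, forall (x x' : nat) (y : gT),
    x < #[g] -> x' < #[g] -> x = x' %[mod l1] -> y \in <[g]> ->
    f (g ^+ x, y) * g ^+ (x' * r) = f (g ^+ x', y) * g ^+ (x * r).
Proof.
case=> l1_dvd l2_dvd [r1 [r2 [a [_ _ aG fE]]]]; exists r1 => x x' y x_lt x'_lt eq_xx'.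
case/cyclePmin => j j_lt ->.
have l1_gt0 := dvdn_gt0 (order_gt0 g) l1_dvd.
have l2_gt0 := dvdn_gt0 (order_gt0 g) l2_dvd.
pose k1 : 'I_l1 := Ordinal (ltn_pmod x l1_gt0).
pose k2 : 'I_l2 := Ordinal (ltn_pmod j l2_gt0).
have x_in : g ^+ x \in cyclo_class g l1 k1 by exact: mem_cyclo_class.
have x'_in : g ^+ x' \in cyclo_class g l1 k1 by rewrite /= eq_xx'; exact: mem_cyclo_class.
have j_in : g ^+ j \in cyclo_class g l2 k2 by exact: mem_cyclo_class.
rewrite (fE _ _ _ _ x_in j_in) (fE _ _ _ _ x'_in j_in).
(* Since [gT] need not be abelian, every factor is written as a power of [g] and the reordering is
   done in the exponents. *)
by have /cycleP[i ->] := aG k1 k2; rewrite -!expgM -!expgD addnAC (addnAC i) addnAC (addnAC i).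
Qed.

End CyclotomicClasses.

Lemma pigeonhole_mod (n l : nat) (U : {set 'I_n}) :
  0 < l -> l < #|U| ->
  exists x x' : 'I_n, [/\ x \in U, x' \in U, x != x' & x = x' %[mod l]].
Proof.
move=> l_gt0 l_lt; pose h (x : 'I_n) := Ordinal (ltn_pmod x l_gt0).
have /dinjectivePn[x xU [x' /andP[neq x'U] /(congr1 val) eq_h]] : ~~ dinjectiveb h (mem U).
  apply/negP => /dinjectiveP /card_in_imset card_h.
  by have := max_card (mem (h @: U)); rewrite card_h card_ord leqNgt l_lt.
by exists x, x'; split; rewrite // eq_sym.
Qed.

Theorem theorem6 (F : finFieldType) (n : nat) (hn : n %| #|F|.-1)
    (gamma : {unit F}) (hgamma : #[gamma]%g = n)
    (U : {set 'I_n}) (N : int) (H : nat) (H_gt0 : 0 < H) (H_le : H <= n)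
    (f : {unit F} * {unit F} -> {unit F}) (hf : maps_into gamma f)
    (l1 l2 : nat) (hl : index_pair gamma f l1 l2)
    (hfUV : forall (x : 'I_n) (y : int), x \in U ->
       (N <= y <= N + H%:Z - 1)%R ->
       f ((gamma ^+ x)%g, expgz gamma y) = expgz gamma (x%:Z * y)%R) :
  minn #|U| H <= maxn l1 l2.
Proof.
have [l1_dvd _ _] := hl.
have l1_gt0 := dvdn_gt0 (order_gt0 gamma) l1_dvd.
rewrite leqNgt gtn_max leq_min; apply/negP => /andP[/andP[U_gt H_gt] _].
have [x [x' [xU x'U neq_xx' eq_mod]]] := pigeonhole_mod _ _ _ l1_gt0 U_gt.
have [r ratio] := index_pair_ratio _ _ _ _ _ hl.
(* This puts both [N] and [N + 1] in the interval of length [H]. *)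
have H_gt1 : 1 < H := leq_ltn_trans l1_gt0 H_gt.
have NV : (N <= N <= N + H%:Z - 1)%R.
  by rewrite -addrA lexx lerDl subr_ge0 lez_nat.
have N1V : (N <= N + 1 <= N + H%:Z - 1)%R.
  rewrite -addrA lerDl lerD2l lerBrDr.
  by rewrite -PoszD lez_nat.
have x_lt : x < #[gamma]%g by rewrite hgamma.
have x'_lt : x' < #[gamma]%g by rewrite hgamma.
have := ratio x x' _ x_lt x'_lt eq_mod (mem_cycle_expgz _ gamma N).
have := ratio x x' _ x_lt x'_lt eq_mod (mem_cycle_expgz _ gamma (N + 1)%R).
(* The relation at [N + 1] becomes the one at [N] with an extra factor [gamma ^+ x] on the left and
   [gamma ^+ x'] on the right; substituting the latter and cancelling equates these factors. *)
rewrite !hfUV // !mulrDr !mulr1 !expgzDn.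
have comm_exp (i j : nat) (z : {unit F}) :
    (z * gamma ^+ i * gamma ^+ j = z * gamma ^+ j * gamma ^+ i)%g.
  by rewrite -!mulgA -!expgD addnC.
rewrite comm_exp => + ratioN; rewrite ratioN comm_exp => /mulIg /mulgI.
(* Both exponents are below the order of [gamma], so congruence is equality. *)
move/eqP; rewrite eq_expg_mod_order !modn_small // => /eqP eq_xx'.
by case/eqP: neq_xx'; apply: val_inj.
Qed.
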